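(* Let $r\geq 3$, let $y_1,\dots,y_r\in\mathbb N_0$, let $S\subseteq[r]$ be nonempty, and let $m$ be an integer with $m\geq\vert S\vert$. Let \[ \mathcal C=\{\mathbf u\in P(m,r): \mathbf u(i)=0 \text{ for some } i\in S\},\qquad \mathcal D=\{\mathbf u\in P(m,r): \mathbf u(i)=y_i \text{ for some } i\in S\}. \] If $\sum_{s\in S}y_s>0$, then $\vert\mathcal D\vert<\vert\mathcal C\vert$.
   Context: $\mathbb N_0$ is the set of non-negative integers, $[r]=\{1,\dots,r\}$, and $P(m,r)=\{(x_1,\dots,x_r)\in\mathbb N_0^r : x_1+\cdots+x_r=m\}$; for $\mathbf u=(u_1,\dots,u_r)$, $\mathbf u(i)=u_i$. *)

(* Defs.v *)
From mathcomp Require Export all_boot.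

Set Implicit Arguments.
Unset Strict Implicit.
Unset Printing Implicit Defensive.

(* Coordinates of a point of P(m,r) are at most m, so {0,...,m} = 'I_m.+1 is
   used in place of the naturals to make the ambient type finite. Indices are
   shifted: [r] = {1,...,r} becomes 'I_r = {0,...,r-1}. *)
Definition P (m r : nat) : {set {ffun 'I_r -> 'I_m.+1}} :=
  [set u : {ffun 'I_r -> 'I_m.+1} | \sum_(i < r) (u i : nat) == m].

Definition C (m r : nat) (S : {set 'I_r}) : {set {ffun 'I_r -> 'I_m.+1}} :=
  [set u in P m r | [exists i in S, (u i : nat) == 0]].

Definition D (m r : nat) (S : {set 'I_r}) (y : 'I_r -> nat) :
    {set {ffun 'I_r -> 'I_m.+1}} :=
  [set u in P m r | [exists i in S, (u i : nat) == y i]].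

(* Main.v *)
Require Import Defs.
From mathcomp Require Import all_boot.
From mathcomp Require Import zify.

Set Implicit Arguments.
Unset Strict Implicit.
Unset Printing Implicit Defensive.

(* It is equivalent to compare complements: there are fewer points of P(m,r)
   that are positive on S than points that avoid the values y_i on S.

   Call a coordinate of u low if it lies in S and u_i <= y_i, and free
   otherwise. Given u positive on S, lower every low coordinate by 1 and add
   the total amount removed to one free coordinate c. The result avoids y, its
   coordinates strictly below y are exactly the low coordinates of u, and the
   free coordinates are unchanged; so if c is chosen as a function of the set
   of free coordinates, u can be recovered. If no coordinate is free, either
   u_i < y_i everywhere and u is kept, or u_c = y_c for some c, which then
   plays the role of the free coordinate. The images thus obtained satisfy the
   condition [canonical] below. A preferred coordinate p is selected as c
   whenever possible; for a suitable p, some point avoiding y is not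
   canonical, which makes the inequality strict. *)

(** * Coding and decoding of points *)

Definition below (r : nat) (S : {set 'I_r}) (y v : 'I_r -> nat) : pred 'I_r :=
  [pred i | (i \in S) && (v i < y i)].

Definition above (r : nat) (S : {set 'I_r}) (y v : 'I_r -> nat) : pred 'I_r :=
  [pred i | (i \notin S) || (y i < v i)].

(** The choice depends on [v] only through [above S y v], so a point and its code with the same
    coordinates above have the same pivot. *)
Definition pivot (r : nat) (S : {set 'I_r}) (y : 'I_r -> nat) (p : 'I_r)
    (v : 'I_r -> nat) : option 'I_r :=
  if above S y v p then Some p else [pick i | above S y v i].

Definition decode (r : nat) (S : {set 'I_r}) (y : 'I_r -> nat) (p : 'I_r)
    (v : 'I_r -> nat) (i : 'I_r) : nat :=
  if pivot S y p v is Some c then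
    if i == c then v c - #|below S y v| else v i + below S y v i
  else v i.

Definition low (r : nat) (S : {set 'I_r}) (y u : 'I_r -> nat) : pred 'I_r :=
  [pred i | (i \in S) && (u i <= y i)].

Definition shift (r : nat) (S : {set 'I_r}) (y u : 'I_r -> nat) (c i : 'I_r) :
    nat :=
  if i == c then u c + #|[pred j | (j != c) && low S y u j]|
  else u i - low S y u i.

(* The last clause says when the point [v] decodes to has value [y c] at the
   pivot [c]: this requires that no coordinate was free, and that [p], which
   is preferred, could not be used instead. *)
Definition canonical (r : nat) (S : {set 'I_r}) (y : 'I_r -> nat) (p : 'I_r)
    (v : 'I_r -> nat) : Prop :=
  [/\ (forall i, ~~ above S y v i) -> forall i, 0 < v i,
      forall c, pivot S y p v = Some c ->
        #|below S y v| + (c \in S) * maxn 1 (y c) <= v c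
    & forall c, pivot S y p v = Some c -> c \in S ->
        v c = #|below S y v| + y c ->
        (forall j, above S y v j -> j = c) /\ (c = p \/ (v p).+1 <> y p)].

Lemma eq_pivot (r : nat) (S : {set 'I_r}) (y : 'I_r -> nat) (p : 'I_r)
    (u v : 'I_r -> nat) :
  above S y u =1 above S y v -> pivot S y p u = pivot S y p v.
Proof. by move=> e; rewrite /pivot e (eq_pick e). Qed.

Lemma pivot_above (r : nat) (S : {set 'I_r}) (y : 'I_r -> nat) (p : 'I_r)
    (v : 'I_r -> nat) (c : 'I_r) :
  pivot S y p v = Some c -> above S y v c.
Proof.
rewrite /pivot; case: ifP => [h [<-] //|_].
by case: pickP => // i h [<-].
Qed.

Lemma pivot_none (r : nat) (S : {set 'I_r}) (y : 'I_r -> nat) (p : 'I_r)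
    (v : 'I_r -> nat) :
  pivot S y p v = None -> forall i, ~~ above S y v i.
Proof.
rewrite /pivot; case: ifP => // _.
by case: pickP => // h _ i; rewrite h.
Qed.

Lemma pivot_unique (r : nat) (S : {set 'I_r}) (y : 'I_r -> nat) (p : 'I_r)
    (v : 'I_r -> nat) (c : 'I_r) :
  (forall i, above S y v i = (i == c)) -> pivot S y p v = Some c.
Proof.
move=> h; rewrite /pivot h; case: eqP => [->//|_].
case: pickP => [i|/(_ c)]; last by rewrite h eqxx.
by rewrite h => /eqP ->.
Qed.

(** * Shifting and coding points positive on [S] *)

Section Shift.

Variables (r : nat) (S : {set 'I_r}) (y u : 'I_r -> nat) (c : 'I_r).
Hypothesis hu : forall i, i \in S -> 0 < u i.

Lemma sum_shift : \sum_i shift S y u c i = \sum_i u i.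
Proof.
rewrite (bigD1 c) //= (bigD1 c (F := u)) //= {1}/shift eqxx.
rewrite -addnA; congr (_ + _).
rewrite -sum1_card big_mkcondr /= -big_split /=.
apply: eq_bigr => i ic; rewrite /shift (negbTE ic).
by rewrite /low /=; case: (boolP (i \in S)) => [/hu|] /=;
  case: (leqP (u i) (y i)) => /=; lia.
Qed.

(** Away from [c], only coordinates already at most [y i] move, and they move down. *)
Lemma above_shift i : i != c -> above S y (shift S y u c) i = above S y u i.
Proof.
move=> ic; rewrite /above /shift /low /= (negbTE ic).
by case: (boolP (i \in S)) => [/hu|] //=; case: (leqP (u i) (y i)) => /=; lia.
Qed.

Hypothesis hc : c \in S -> y c <= u c.

(** Lowering a low coordinate, which is positive, puts it strictly below [y i]. The coordinate [c]
    only grows, so it is never below. *)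
Lemma below_shift :
  below S y (shift S y u c) =1 [pred i | (i != c) && low S y u i].
Proof.
move=> i; rewrite /below /shift /=; case: eqP => [->|_] /=.
  by case: (boolP (c \in S)) => [/hc|] //=; lia.
rewrite /low /=; case: (boolP (i \in S)) => [/hu|] //=.
by case: (leqP (u i) (y i)) => /=; lia.
Qed.

Lemma card_below_shift :
  #|below S y (shift S y u c)| = #|[pred i | (i != c) && low S y u i]|.
Proof. exact: eq_card below_shift. Qed.

Lemma shift_pivot : shift S y u c c = u c + #|below S y (shift S y u c)|.
Proof. by rewrite card_below_shift /shift eqxx. Qed.

Lemma shift_avoids :
  above S y (shift S y u c) c ->
  forall i, i \in S -> shift S y u c i <> y i.
Proof.
move=> hac i iS; case: (eqVneq i c) => [e|ic].
  by move: hac; rewrite -e /above /= iS /=; lia.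
by rewrite /shift /low (negbTE ic) /= iS /=; have := hu iS;
  case: (leqP (u i) (y i)) => /=; lia.
Qed.

Lemma shiftK (p : 'I_r) :
  pivot S y p (shift S y u c) = Some c ->
  decode S y p (shift S y u c) =1 u.
Proof.
move=> hp i; rewrite /decode hp; case: eqP => [->|/eqP ic].
  by rewrite shift_pivot addnK.
rewrite below_shift /= ic /shift (negbTE ic) /low /=.
by case: (boolP (i \in S)) => [/hu|] //=; case: (leqP (u i) (y i)) => /=; lia.
Qed.

End Shift.

Lemma canonical_code (r : nat) (hr : 1 < r) (S : {set 'I_r})
    (y : 'I_r -> nat) (p : 'I_r) (u : 'I_r -> nat) :
  (forall i, i \in S -> 0 < u i) ->
  exists v : 'I_r -> nat,
    [/\ \sum_i v i = \sum_i u i, forall i, i \in S -> v i <> y i,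
        decode S y p v =1 u & canonical S y p v].
Proof.
move=> hu; case hp : (pivot S y p u) => [c|].
  have ac := pivot_above hp.
  have hc : c \in S -> y c < u c.
    by move: ac; rewrite /above /= => + cS; rewrite cS.
  have hc' : c \in S -> y c <= u c by move/hc/ltnW.
  have ea : above S y (shift S y u c) =1 above S y u.
    move=> i; case: (eqVneq i c) => [->|]; last exact: above_shift.
    rewrite ac /above /= shift_pivot //.
    by case: (boolP (c \in S)) => //= /hc; lia.
  have hpv : pivot S y p (shift S y u c) = Some c by rewrite (eq_pivot p ea).
  exists (shift S y u c); split.
  - exact: sum_shift.
  - by apply: shift_avoids => //; rewrite ea.
  - exact: shiftK.
  - split.
    + by move/(_ c); rewrite ea ac.
    + move=> c'; rewrite hpv => -[<-]; rewrite shift_pivot // addnC leq_add2r.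
      by case: (boolP (c \in S)) => //= /hc; lia.
    (* Here [u c] exceeds [y c] strictly, so the equality in the last clause cannot occur. *)
    + move=> c'; rewrite hpv => -[<-] cS; rewrite shift_pivot //.
      by have := hc cS; lia.
(* No coordinate is free: [S] contains every index and [u] is at most [y]. *)
have na := pivot_none hp.
have aS i : i \in S by move: (na i); rewrite /above /= negb_or negbK => /andP[].
have le i : u i <= y i.
  by move: (na i); rewrite /above /= negb_or => /andP[_]; rewrite -leqNgt.
case: (pickP [pred i | u i == y i]) => [d /= /eqP ed|hlt]; last first.
  exists u; split => //.
  - by move=> i _ /eqP; rewrite [_ == _]hlt.
  - by move=> i; rewrite /decode hp.
  - by split => [_ i|c|c]; rewrite ?hp //; apply: hu.
pose c := if u p == y p then p else d.
have ec : u c = y c by rewrite /c; case: eqP.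
have hc' : c \in S -> y c <= u c by rewrite ec.
(* The [r - 1] coordinates other than [c] are all low, so [c] rises strictly above [y c] and becomes
   the only coordinate above. *)
have kpos : 0 < #|below S y (shift S y u c)|.
  rewrite card_below_shift //.
  rewrite (eq_card (B := predC1 c)).
    by rewrite cardC1 card_ord; lia.
  by move=> i; rewrite !inE /low /= aS le !andbT.
have ea i : above S y (shift S y u c) i = (i == c).
  case: (eqVneq i c) => [->|ic]; last by rewrite above_shift //; apply: negbTE.
  by rewrite /above /= shift_pivot // ec; apply/orP; right; lia.
have hpv := pivot_unique p ea.
exists (shift S y u c); split.
- exact: sum_shift.
- by apply: shift_avoids => //; rewrite ea eqxx.
- exact: shiftK.
- split.
  + by move/(_ c); rewrite ea eqxx.
  + move=> c'; rewrite hpv => -[<-]; rewrite shift_pivot // addnC leq_add2r.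
    by have := hu c (aS c); rewrite aS ec; lia.
  + move=> c'; rewrite hpv => -[<-] _ _; split.
      by move=> j; rewrite ea => /eqP.
    (* If [c] is not [p], then [u p < y p] by the choice of [c], and lowering [u p] leaves a gap of
       at least 2. *)
    case: (eqVneq c p) => [|cp]; [by left | right].
    rewrite /shift eq_sym (negbTE cp) /low /= aS le /=.
    have := hu p (aS p); move: cp; rewrite /c.
    by case: (eqVneq (u p) (y p)) => [_|/eqP]; [rewrite eqxx | lia].
Qed.

(** * Points avoiding [y] that are not canonical *)

Lemma canonical_pref (r : nat) (S : {set 'I_r}) (y : 'I_r -> nat)
    (p : 'I_r) (v : 'I_r -> nat) :
  above S y v p -> canonical S y p v ->
  #|below S y v| + (p \in S) * maxn 1 (y p) <= v p.
Proof. by move=> ap [_ h _]; apply: h; rewrite /pivot ap. Qed.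

Definition two_values (r : nat) (p j : 'I_r) (a b : nat) (e : 'I_r -> nat)
    (i : 'I_r) : nat :=
  if i == p then a else if i == j then b else e i.

Lemma sum_two_values (r : nat) (p j : 'I_r) (a b : nat) (e : 'I_r -> nat) :
  j != p ->
  \sum_i two_values p j a b e i = a + (b + \sum_(i | (i != p) && (i != j)) e i).
Proof.
move=> jp; rewrite (bigD1 p) //= (bigD1 j) //=.
rewrite /two_values eqxx (negbTE jp) eqxx.
by congr (_ + (_ + _)); apply: eq_bigr => i /andP[/negbTE -> /negbTE ->].
Qed.

Lemma two_below (r : nat) (S : {set 'I_r}) (y v : 'I_r -> nat) (s j : 'I_r) :
  s != j -> below S y v s -> below S y v j -> 1 < #|below S y v|.
Proof.
move=> sj hs hj; have <- : #|[set s; j]| = 2 by rewrite cards2 sj.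
by apply/subset_leq_card/subsetP => i; rewrite !inE => /orP[] /eqP ->.
Qed.

Lemma one_below (r : nat) (S : {set 'I_r}) (y v : 'I_r -> nat) (s : 'I_r) :
  below S y v s -> 0 < #|below S y v|.
Proof. by move=> hs; apply/card_gt0P; exists s. Qed.

Lemma ord_avoid2 (r : nat) (hr : 2 < r) (a b : 'I_r) :
  exists c : 'I_r, (c != a) && (c != b).
Proof.
have /subsetPn[c _] : ~~ ([set: 'I_r] \subset [set a; b]).
  apply/negP => /subset_leq_card; rewrite cardsT card_ord cards2.
  by case: (a != b); lia.
by rewrite !inE negb_or; exists c.
Qed.

(* Here the pivot [p] of the non-canonical point would decode to a value that
   is negative, or zero in [S]. *)
Lemma noncanonical_free (r : nat) (hr : 2 < r) (S : {set 'I_r})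
    (y : 'I_r -> nat) (m : nat) (hm : #|S| <= m) (s p : 'I_r) :
  s \in S -> 0 < y s -> (p \notin S) || (y p == 0) ->
  exists v : 'I_r -> nat,
    [/\ \sum_i v i = m, forall i, i \in S -> v i <> y i
      & ~ canonical S y p v].
Proof.
move=> sS ys hp.
have sp : s != p.
  by apply/eqP => e; move: hp; rewrite -e sS /= => /eqP; lia.
have [j /andP[jp js]] := ord_avoid2 hr p s.
(* The least value allowed at [i]. *)
pose e i : nat := (i \in S) && (y i == 0).
pose R := \sum_(i | (i != p) && (i != j)) e i.
have es : e s = 0 by rewrite /e sS /=; case: eqP => //; lia.
(* Compare termwise with the indicator of [S]; strictness comes from [s], which counts 1 in [S]
   while [e s = 0]. *)
have hR : (p \in S) + R + (j \in S) < m.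
  apply: leq_trans hm.
  have <- : \sum_i (i \in S) = #|S| by rewrite -sum1_card [RHS]big_mkcond.
  rewrite (bigD1 p) //= (bigD1 j) //=.
  rewrite /R (bigD1 s) ?[(s != p) && _]andbC ?sp /= 1?eq_sym ?js //.
  rewrite es add0n.
  rewrite [X in _ + (_ + X)](bigD1 s) ?[(s != p) && _]andbC ?sp /=
    1?eq_sym ?js //.
  rewrite sS -addnA ltn_add2l addnC ltn_add2l add1n ltnS.
  by apply: leq_sum => i _; rewrite /e; case: (i \in S) => //=; case: eqP.
pose t := m - (p \in S) - R.
have tE : (p \in S) + R + t = m by clear -hR; rewrite /t; lia.
have ht : (j \in S) < t by clear -hR; rewrite /t; lia.
clearbody t; clear hR.
(* The remainder [t] goes to [j]; if it is the forbidden value [y j], one unit is moved to [p]. *)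
pose d : nat := (j \in S) && (t == y j).
pose v := two_values p j ((p \in S) + d) (t - d) e.
have vp : v p = (p \in S) + d by rewrite /v /two_values eqxx.
have vj : v j = t - d by rewrite /v /two_values (negbTE jp) eqxx.
have vo i : i != p -> i != j -> v i = e i.
  by move=> h1 h2; rewrite /v /two_values (negbTE h1) (negbTE h2).
have dS : d <= (j \in S) by rewrite /d; case: (j \in S); case: eqP.
have ap : above S y v p.
  by rewrite /above /= vp; case: (boolP (p \in S)) hp => //= _ /eqP ->; lia.
have bs : below S y v s by rewrite /below /= sS vo ?es // eq_sym.
exists v; split.
- by rewrite sum_two_values // -/R; clear -tE dS ht; lia.
- move=> i iS; case: (eqVneq i p) => [ip|ip].
    by move: ap; rewrite -ip /above /= iS /= => h e'; rewrite e' ltnn in h.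
  case: (eqVneq i j) => [ij|ij].
    subst i; rewrite vj /d iS /=; rewrite iS in ht.
    by case: eqP => /= [<-|]; rewrite ?subn0 //; clear -ht; lia.
  by rewrite vo // /e iS /=; case: eqP => [->|h /esym].
(* The bound at the pivot would force at most [d] coordinates below, but [s] is below, and so is [j]
   when [d = 1]. *)
- move/(canonical_pref ap); rewrite vp.
  have : d < #|below S y v|.
    case: (posnP d) => [->|d1]; first exact: one_below bs.
    have d2 : d < 2 by apply: leq_ltn_trans dS _; case: (j \in S).
    apply: leq_trans d2 (two_below _ bs (_ : below S y v j)).
      by rewrite eq_sym.
    move: (d1); rewrite /d; case: (boolP (j \in S)) => //= jS.
    case: eqP => // tj _.
    by rewrite /below /= jS vj -tj; rewrite jS in ht; clear -ht d1; lia.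
  by move: #|_| => k; clearbody d; clear; case: (p \in S); lia.
Qed.

(** As [y] is positive, 0 is allowed everywhere and lies below [y]; points with at most two nonzero
    coordinates suffice. *)
Lemma noncanonical_positive (r : nat) (hr : 2 < r) (y : 'I_r -> nat)
    (m : nat) (hm : r <= m) :
  (forall i, 0 < y i) ->
  exists (p : 'I_r) (v : 'I_r -> nat),
    [/\ \sum_i v i = m, forall i, v i <> y i & ~ canonical [set: 'I_r] y p v].
Proof.
move=> ypos; pose z (_ : 'I_r) := 0.
have sum2 p j a b : j != p -> \sum_i two_values p j a b z i = a + b.
  by move=> jp; rewrite sum_two_values // big1 // addn0.
have val2 p j a b : j != p ->
    let v := two_values p j a b z in
    [/\ v p = a, v j = b & forall i, i != p -> i != j -> v i = 0].
  move=> jp /=; rewrite /two_values eqxx (negbTE jp) eqxx; split=> // i.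
  by move=> /negbTE -> /negbTE ->.
have avoid2 p j a b : j != p -> a <> y p -> b <> y j ->
    forall i, two_values p j a b z i <> y i.
  move=> jp ha hb i; rewrite /two_values.
  case: eqP => [->//|_]; case: eqP => [->//|_].
  by rewrite /z; have := ypos i; lia.
have aE v i : above [set: 'I_r] y v i = (y i < v i) by rewrite /above /= inE.
have bE v i : below [set: 'I_r] y v i = (v i < y i) by rewrite /below /= inE.
have triple p : exists j s : 'I_r, [/\ j != p, s != p & s != j].
  have [j /andP[jp _]] := ord_avoid2 hr p p.
  by have [s /andP[sp sj]] := ord_avoid2 hr p j; exists j, s.
case: (pickP [pred p | y p + r <= m.+1]) => [p /= hyp|hbig].
  exists p; have [j [s [jp sp sj]]] := triple p.
  (* The point with [y p + 1] at [p] and the rest at [j] avoids [y] unless the rest is [y j]; in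
     that case two units are moved from [p] to [j]. *)
  case: (eqVneq (m - (y p).+1) (y j)) => [e|ne].
    exists (two_values p j (y p).-1 (y j).+2 z); split.
    - by rewrite sum2 //; have := ypos p; lia.
    - by apply: avoid2 => //; have := ypos p; lia.
    - have [] := val2 p j (y p).-1 (y j).+2 jp.
      set v := two_values _ _ _ _ _ => vp vj vo.
      have ea i : above [set: 'I_r] y v i = (i == j).
        rewrite aE; case: (eqVneq i j) => [->|ij]; first by rewrite vj; lia.
        case: (eqVneq i p) => [->|ip]; first by rewrite vp; lia.
        by rewrite vo.
      have hpj := pivot_unique p ea.
      have k2 : 1 < #|below [set: 'I_r] y v|.
        apply: (@two_below _ _ _ _ s p) => //; rewrite bE.
          by rewrite vo.
        by rewrite vp; have := ypos p; lia.
      (* The bound at the pivot [j] allows at most two coordinates below, hence exactly two, so the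
         last clause applies. It fails because [j] is not [p] and [v p] is [y p - 1]. *)
      case=> _ /(_ j hpj) + /(_ j hpj (in_setT j)).
      rewrite vj vp inE => h1 h2.
      case: h2 => [|_ [jp'|]]; first by lia.
        by rewrite jp' eqxx in jp.
      by have := ypos p; lia.
  exists (two_values p j (y p).+1 (m - (y p).+1) z); split.
  - by rewrite sum2 //; lia.
  - by apply: avoid2 => //; [lia | apply/eqP].
  - have [] := val2 p j (y p).+1 (m - (y p).+1) jp.
    set v := two_values _ _ _ _ _ => vp vj vo.
    have ap : above [set: 'I_r] y v p by rewrite aE vp.
    have bs : below [set: 'I_r] y v s by rewrite bE vo.
    have hpp : pivot [set: 'I_r] y p v = Some p by rewrite /pivot ap.
    have k1 := one_below bs.
    (* The bound at [p] leaves only [s] below, and the last clause then leaves only [p] above; but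
       [j] is either below or above. *)
    case=> _ /(_ p hpp) + /(_ p hpp (in_setT p)).
    rewrite vp inE => h1 h2.
    case: h2 => [|h2 _]; first by lia.
    case: (ltngtP (m - (y p).+1) (y j)) => hj; last by rewrite hj eqxx in ne.
      have : 1 < #|below [set: 'I_r] y v|.
        by apply: (@two_below _ _ _ _ s j); rewrite // bE vj.
      by lia.
    have /h2 jp' : above [set: 'I_r] y v j by rewrite aE vj.
    by rewrite jp' eqxx in jp.
(* Now every [y i] is large: lifting a coordinate above [y i] leaves less than the bound at the
   pivot needs for [r - 1] coordinates below. *)
have big i : m.+1 < y i + r by rewrite ltnNge; apply/negbT/(hbig i).
case: (pickP [pred p | y p != m]) => [p /= hyp|hall].
  exists p; have [j [s [jp sp sj]]] := triple p.
  exists (two_values p j m 0 z); split.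
  - by rewrite sum2 // addn0.
  - apply: avoid2 => //; first by apply/eqP; rewrite eq_sym.
    by have := ypos j; lia.
  - have [] := val2 p j m 0 jp.
    set v := two_values _ _ _ _ _ => vp vj vo.
    have v0 i : i != p -> v i = 0.
      by move=> ip; case: (eqVneq i j) => [->|]; [exact: vj | exact: vo].
    (* If [y p < m], the [r - 1] zeros are below and break the bound at [p]. If [y p > m], nothing
       is above and the zero at [j] breaks the first clause. *)
    case: (ltngtP (y p) m) => hm'; last by rewrite hm' eqxx in hyp.
      have ap : above [set: 'I_r] y v p by rewrite aE vp.
      have : r.-1 <= #|below [set: 'I_r] y v|.
        have <- : #|predC1 p| = r.-1 by rewrite cardC1 card_ord.
        apply/subset_leq_card/subsetP => i; rewrite !inE => ip.
        by rewrite v0 // ypos.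
      by move=> hk /(canonical_pref ap); rewrite vp inE; have := big p; lia.
    case=> h _ _.
    have : 0 < v j.
      apply: h => i; rewrite aE; case: (eqVneq i p) => [->|ip].
        by rewrite vp; lia.
      by rewrite v0.
    by rewrite vj.
(* All [y i] equal [m], so nothing can be above. Splitting [m] as [m - 1] and 1 avoids the value
   [m], and the zero at [s] breaks the first clause. *)
have ym i : y i = m by apply/eqP; apply: negbFE (hall i).
have r0 : 0 < r by lia.
pose p := Ordinal r0; exists p; have [j [s [jp sp sj]]] := triple p.
exists (two_values p j m.-1 1 z); split.
- by rewrite sum2 //; lia.
- by apply: avoid2 => //; rewrite ym; lia.
- have [] := val2 p j m.-1 1 jp.
  set v := two_values _ _ _ _ _ => vp vj vo.
  case=> h _ _.
  have : 0 < v s.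
    apply: h => i; rewrite aE ym; case: (eqVneq i p) => [->|ip].
      by rewrite vp; lia.
    by case: (eqVneq i j) => [->|ij]; [rewrite vj; lia | rewrite vo].
  by rewrite vo.
Qed.

(** An index outside [S] or with [y p = 0] serves as [p]; failing that, [S] is the whole index set
    and [y] is positive. *)
Lemma noncanonical_exists (r : nat) (hr : 2 < r) (y : 'I_r -> nat)
    (S : {set 'I_r}) (m : nat) (hm : #|S| <= m) :
  0 < \sum_(s in S) y s ->
  exists (p : 'I_r) (v : 'I_r -> nat),
    [/\ \sum_i v i = m, forall i, i \in S -> v i <> y i
      & ~ canonical S y p v].
Proof.
rewrite lt0n sum_nat_eq0 negb_forall => /existsP[s].
rewrite negb_imply -lt0n => /andP[sS ys].
case: (pickP [pred p | (p \notin S) || (y p == 0)]) => [p hp|full].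
  by exists p; apply: (noncanonical_free hr hm sS ys).
have eS : S = [set: 'I_r].
  by apply/setP => i; rewrite inE; have := full i => /=; case: (i \in S).
have ypos i : 0 < y i.
  by rewrite lt0n; have /negbT/norP[] := full i.
have hm' : r <= m by move: hm; rewrite eS cardsT card_ord.
have [p [v [h1 h2 h3]]] := noncanonical_positive hr hm' ypos.
by exists p, v; rewrite eS.
Qed.

(** * Transfer to finite functions and the count *)

Lemma P_point (m r : nat) (v : 'I_r -> nat) :
  \sum_i v i = m ->
  exists w : {ffun 'I_r -> 'I_m.+1}, w \in P m r /\ (fun i => w i : nat) =1 v.
Proof.
move=> hv; have hw i : v i < m.+1 by rewrite ltnS -hv (bigD1 i) //= leq_addr.
pose w := [ffun i => Ordinal (hw i)].
have e : (fun i => w i : nat) =1 v by move=> i; rewrite ffunE.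
exists w; split=> //; rewrite inE; apply/eqP; apply: etrans hv.
by apply: eq_bigr => i _; apply: e.
Qed.

Lemma eq_decode (r : nat) (S : {set 'I_r}) (y : 'I_r -> nat) (p : 'I_r)
    (u v : 'I_r -> nat) : u =1 v -> decode S y p u =1 decode S y p v.
Proof.
move=> e i; have ea : above S y u =1 above S y v.
  by move=> k; rewrite /above /= e.
have eb : below S y u =1 below S y v by move=> k; rewrite /below /= e.
rewrite /decode (eq_pivot p ea) (eq_card eb) e eb.
by case: pivot => // c; rewrite e.
Qed.

Lemma eq_canonical (r : nat) (S : {set 'I_r}) (y : 'I_r -> nat) (p : 'I_r)
    (u v : 'I_r -> nat) : u =1 v -> canonical S y p u -> canonical S y p v.
Proof.
move=> e; have ea : above S y u =1 above S y v.
  by move=> k; rewrite /above /= e.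
have eb : below S y u =1 below S y v by move=> k; rewrite /below /= e.
rewrite /canonical (eq_pivot p ea) (eq_card eb) => -[h1 h2 h3]; split.
- by move=> h i; rewrite -e; apply: h1 => k; rewrite ea.
- by move=> c hc; rewrite -e; apply: h2.
- move=> c hc cS; rewrite -!e => h; have [h4 h5] := h3 c hc cS h.
  by split=> // j; rewrite -ea; apply: h4.
Qed.

Theorem theorem2p4 (r : nat) (hr : 3 <= r) (y : 'I_r -> nat) (S : {set 'I_r})
  (hS : S != set0) (m : nat) (hm : #|S| <= m)
  (hy : 0 < \sum_(s in S) y s) :
  #|D m S y| < #|C m S|.
Proof.
have [p [v0 [sv0 av0 nc0]]] := noncanonical_exists hr hm hy.
have inD (w : {ffun 'I_r -> 'I_m.+1}) : w \in P m r ->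
    (forall i, i \in S -> w i <> y i :> nat) -> w \in P m r :\: D m S y.
  move=> wP h; rewrite in_setD wP andbT inE wP /=.
  by apply/existsP => -[i /andP[iS /eqP]]; apply: h.
have [w0 [w0P e0]] := P_point sv0.
have w0D : w0 \in P m r :\: D m S y.
  by apply: inD => // i iS; rewrite [w0 i : nat]e0; apply: av0.
(* The default value of [inord] is harmless: [g] only has to cover the points positive on [S], and a
   code of such a point decodes to values at most [m]. *)
pose g (w : {ffun 'I_r -> 'I_m.+1}) : {ffun 'I_r -> 'I_m.+1} :=
  [ffun i => inord (decode S y p (fun k => w k) i)].
have sub : P m r :\: C m S \subset g @: ((P m r :\: D m S y) :\ w0).
  apply/subsetP => u; rewrite in_setD => /andP[uC uP].
  have hu i : i \in S -> 0 < u i.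
    move=> iS; rewrite lt0n; apply: contra uC => hi.
    by rewrite inE uP /=; apply/existsP; exists i; rewrite iS.
  have r1 : 1 < r by lia.
  have [v [sv av dv cv]] := canonical_code r1 y p hu.
  have su : \sum_i (u i : nat) = m by move: uP; rewrite inE => /eqP.
  rewrite su in sv; have [w [wP e]] := P_point sv.
  apply/imsetP; exists w.
    rewrite in_setD1; apply/andP; split; last first.
      by apply: inD => // i iS; rewrite [w i : nat]e; apply: av.
    (* Codes are canonical and [v0] is not, so [w0] can be removed from the domain. *)
    apply: contra_notN nc0 => /eqP ww0.
    by apply: eq_canonical cv => i; rewrite -e -e0 ww0.
  by apply/ffunP => i; rewrite ffunE (eq_decode S y p e) dv inord_val.
have lt : #|P m r :\: C m S| < #|P m r :\: D m S y|.
  rewrite (cardsD1 w0 (P m r :\: D m S y)) w0D add1n ltnS.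
  exact: leq_trans (subset_leq_card sub) (leq_imset_card _ _).
have PI (A : {set {ffun 'I_r -> 'I_m.+1}}) : A \subset P m r ->
    #|P m r| = #|A| + #|P m r :\: A|.
  by move=> /setIidPr e; rewrite -{1}e cardsID.
have CP : C m S \subset P m r by apply/subsetP => u; rewrite inE => /andP[].
have DP : D m S y \subset P m r by apply/subsetP => u; rewrite inE => /andP[].
by have := PI _ CP; have := PI _ DP; lia.
Qed.
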